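(* Let $\lambda\in(-2,2)$ and $\eta\in\mathbb{R}$ be fixed. There is a positive constant $C$ depending on $\lambda$ and $\eta$ such that within $B(R)$, there are at least $CR$ periodic orbits of the dynamics $(x,y)\mapsto (y,-\lfloor \lambda y+x+\eta\rfloor)$ on $\mathbb{Z}^2$.
   Context: Here $\lfloor\cdot\rfloor$ is the floor function, $R$ is a positive real number, and $B(R)$ is the ball of radius $R$ in $\mathbb{R}^2$ centered at the origin. Write $F_\eta(x,y)=(y,-\lfloor \lambda y+x+\eta\rfloor)$, which is a bijection of $\mathbb{Z}^2$. The orbit of $(x,y)\in\mathbb{Z}^2$ is $(F_\eta^n(x,y))_{n\in\mathbb{Z}}$, and it is periodic if $F_\eta^p(x,y)=(x,y)$ for some positive integer $p$. The validity of the statement is invariant under affine changes of coordinates fixing the origin, up to an appropriate change of the constant $C$.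
   Formalization: The bound is stated for all R ≥ R_0, with R_0 > 0 depending on λ and η, instead of all R > 0: for λ=0, η=1, R=1/2 the only lattice point of B(R) is the origin, which maps to (0,-1), so no orbit lies within B(R) although CR > 0. *)

(* Defs.v *)
From mathcomp Require Import all_boot all_order all_algebra.
From mathcomp Require Import all_classical all_reals.

Set Implicit Arguments.
Unset Strict Implicit.
Unset Printing Implicit Defensive.

Import Order.TTheory GRing.Theory Num.Theory.

Local Open Scope classical_set_scope.
Local Open Scope ring_scope.

Definition drot (R : realType) (lambda eta : R) (p : int * int) : int * int :=
  (p.2, - Num.floor (lambda * p.2%:~R + p.1%:~R + eta)).

(* Since the first coordinate is an integer, it comes out of the floor; hence
   the explicit inverse. *)
Definition drot_inv (R : realType) (lambda eta : R) (p : int * int) :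
    int * int :=
  (- p.2 - Num.floor (lambda * p.1%:~R + eta), p.1).

Lemma drotE (R : realType) (lambda eta : R) (p : int * int) :
  drot lambda eta p =
  (p.2, - p.1 - Num.floor (lambda * p.2%:~R + eta)).
Proof.
rewrite /drot addrAC floorDrz ?intr_int // intrKfloor.
by rewrite opprD (addrC (- p.1)).
Qed.

Lemma drotK (R : realType) (lambda eta : R) :
  cancel (drot lambda eta) (drot_inv lambda eta).
Proof.
by case=> x y; rewrite drotE /drot_inv /= opprB opprK addrAC subrr add0r.
Qed.

Lemma drot_invK (R : realType) (lambda eta : R) :
  cancel (drot_inv lambda eta) (drot lambda eta).
Proof.
by case=> x y; rewrite drotE /drot_inv /= opprB opprK addrAC subrr add0r.
Qed.

Lemma drot_bij (R : realType) (lambda eta : R) : bijective (drot lambda eta).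
Proof. exact: Bijective (@drotK R lambda eta) (@drot_invK R lambda eta). Qed.

Definition drot_iter (R : realType) (lambda eta : R) (n : int)
    (p : int * int) : int * int :=
  match n with
  | Posz k => iter k (drot lambda eta) p
  | Negz k => iter k.+1 (drot_inv lambda eta) p
  end.

(* Orbits are taken as sets of points, so that points of the same orbit are
   not counted separately. *)
Definition drot_orbit (R : realType) (lambda eta : R) (p : int * int) :
    set (int * int) :=
  [set drot_iter lambda eta n p | n in [set: int]].

Definition drot_periodic (R : realType) (lambda eta : R) (p : int * int) :
    Prop :=
  exists2 k : nat, (0 < k)%N & iter k (drot lambda eta) p = p.

(* Lattice points of the Euclidean ball; the library's [ball] on a product
   type is the one of the sup norm. *)
Definition lattice_ball (R : realType) (r : R) : set (int * int) :=
  [set p | Num.sqrt (p.1%:~R ^+ 2 + p.2%:~R ^+ 2) < r].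

Definition periodic_orbits_within (R : realType) (lambda eta r : R) :
    set (set (int * int)) :=
  [set O | exists p : int * int,
    [/\ drot_periodic lambda eta p, O = drot_orbit lambda eta p
      & O `<=` lattice_ball r]].

(* Main.v *)
(* The map is the composition of the two involutions [swap : (x, y) |-> (y, x)]
   and [(x, y) |-> (- x - m y, y)], where [m y = floor (lambda * y + eta)].
   Call symmetric the fixed points of either one: an orbit that visits
   symmetric points twice is periodic, so that distinct symmetric points whose
   orbits leave a region do so along disjoint pieces of orbits. For the weight
   [V = max 0 (L ^ 2 - Q)], with [Q] the invariant quadratic form centred at a
   suitable point of the diagonal, the total weight of the symmetric points
   with escaping orbits is therefore at most the total decrease of [V] along
   the map. The second involution preserves the rows and reflects row [y]
   about a point at distance [|kappa - w y| / 2] from the axis of [Q], where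
   [w y] is the fractional part of [lambda * y + eta]; hence the decrease in
   row [y] is, up to lower order, [|kappa - w y|] times the maximal weight of
   the row, while the fixed points of this involution contribute that maximal
   weight once for each even [m y]. Almost half of the [m y] are even, and
   [|kappa - w y|] exceeds that frequency by arbitrarily little, so the two
   contributions balance up to [delta * L ^ 3], and the diagonal, of weight of
   order [L ^ 3], is left over. *)
Require Import Defs.
From mathcomp Require Import all_boot all_order all_algebra.
From mathcomp Require Import all_classical all_reals.
From mathcomp Require Import zify ring lra.

Set Implicit Arguments.
Unset Strict Implicit.
Unset Printing Implicit Defensive.

Import Order.TTheory GRing.Theory Num.Theory.

Local Open Scope classical_set_scope.
Local Open Scope card_scope.
Local Open Scope ring_scope.

(** * Reversibility and symmetric points of orbits *)

Section Symmetry.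
Variables (R : realType) (lambda eta : R).
Local Notation F := (drot lambda eta).

Definition swap (p : int * int) : int * int := (p.2, p.1).

(** Time reversal: as [swap \o F] is an involution, [swap] conjugates [F] to its inverse. *)
Lemma drot_swap (p : int * int) : F (swap (F p)) = swap p.
Proof. by case: p => x y; rewrite !drotE /swap /= opprB opprK addrAC subrr add0r. Qed.

Lemma drot_inj : injective F.
Proof. exact: can_inj (@drotK R lambda eta). Qed.

Lemma iter_drot_inj k : injective (iter k F).
Proof. by elim: k => //= k IH x y /drot_inj /IH. Qed.

Lemma iter_drot_swap k p : iter k F (swap (iter k F p)) = swap p.
Proof. by elim: k => //= k IH; rewrite -iterS iterSr drot_swap. Qed.

(* For [t = 0] these are the fixed points of [swap], and for [t = 1] the swaps
   of the fixed points of the second involution [swap \o F]. *)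
Definition symmetric (t : bool) (p : int * int) : Prop :=
  iter t F (swap p) = p.

(** Each symmetric point makes [swap] act on the orbit as a reflection of time; comparing the
    reflections at times 0 and [k] gives a translation by [k.*2 + t - t']. *)
Lemma symmetric_return (t t' : bool) k p :
  symmetric t p -> symmetric t' (iter k F p) ->
  iter (k.*2 + t) F p = iter t' F p.
Proof.
move=> sp sq.
have : iter (k + t + t') F (swap (iter k F p)) = iter (k + t) F (iter k F p).
  by rewrite iterD sq.
rewrite -iterD -[in LHS]addnA addnC iterD iter_drot_swap addnC iterD sp.
by rewrite addnAC addnn => ->.
Qed.

Lemma symmetric_both p :
  symmetric false p -> symmetric true p -> F p = p.
Proof. by rewrite /symmetric /= => ->. Qed.

(** By [symmetric_return] the orbit is periodic, and one period consists of points of the segment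
    and their mirror images under [swap]. *)
Lemma symmetric_return_stay (P : int * int -> Prop) (t t' : bool) k p :
  (forall q, P q -> P (swap q)) ->
  symmetric t p -> symmetric t' (iter k.+1 F p) ->
  (forall j, (j <= k.+1)%N -> P (iter j F p)) ->
  forall i, P (iter i F p).
Proof.
move=> Psw sp sq Pp.
have per : iter (k.+1.*2 + t - t') F p = p.
  apply: (@iter_drot_inj t'); rewrite -iterD subnKC; last by case: (t'); lia.
  exact: symmetric_return sp sq.
set n := (_ - _)%N in per.
have n_gt0 : (0 < n)%N by rewrite /n; case: (t) (t') => [] []; lia.
have small i : (i < n)%N -> P (iter i F p).
  move=> i_lt; have [/Pp//|k_lt] := leqP i k.+1.
  have i_le : (i + t <= n)%N by move: i_lt k_lt; rewrite /n; case: (t) (t') => [] []; lia.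
  (* The reflection sends time [i] to [n - t - i], up to a period, and this time lies in the
     segment. *)
  set j := (n - t - i)%N.
  suff -> : iter i F p = swap (iter j F p).
    by apply: Psw; apply: Pp; rewrite /j /n; move: k_lt; case: (t) (t') => [] []; lia.
  apply: (@iter_drot_inj (t + j)); rewrite -iterD.
  by rewrite [in RHS]iterD iter_drot_swap sp (_ : t + j + i = n)%N // /j; lia.
move=> i; elim/ltn_ind: i => i IH; have [/small//|n_le] := ltnP i n.
rewrite -(subnK n_le) iterD per; apply: IH; lia.
Qed.

Lemma periodic_iterM k m p : iter k F p = p -> iter (m * k) F p = p.
Proof. by move=> per; elim: m => //= m IH; rewrite mulSn iterD IH. Qed.

Lemma drot_orbit_iter p q :
  drot_periodic lambda eta p -> drot_orbit lambda eta p q ->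
  exists i, q = iter i F p.
Proof.
have iterK m r : iter m (drot_inv lambda eta) (iter m F r) = r.
  by elim: m r => // m IH r; rewrite iterSr [in iter m.+1 _ _]iterS drotK IH.
case=> k k_gt0 per [[n|n] _ <-]; first by exists n.
exists (n.+1 * k - n.+1)%N; rewrite /drot_iter.
rewrite -[in LHS](periodic_iterM n.+1 per).
have n_le : (n.+1 <= n.+1 * k)%N by rewrite leq_pmulr.
by rewrite -[in LHS](subnKC n_le) iterD iterK.
Qed.

Lemma drot_orbit_refl p : drot_orbit lambda eta p p.
Proof. by exists 0. Qed.

(* With [n] the least period, the symmetric points of one type on the orbit
   of [p] are among [p] and its antipode [iter (n / 2) F p]. *)
Lemma orbit_symmetric (t : bool) p :
  drot_periodic lambda eta p -> symmetric t p ->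
  exists q, forall r, drot_orbit lambda eta p r -> symmetric t r ->
    r = p \/ r = q.
Proof.
move=> perp sp.
have ex : exists n, (0 < n)%N && (iter n F p == p).
  by have [k k_gt0 /eqP per] := perp; exists k; rewrite k_gt0.
case: (ex_minnP ex) => n /andP[n_gt0 /eqP per] n_min.
exists (iter n./2 F p) => r /(drot_orbit_iter perp)[i ->] si.
have modE j : iter j F p = iter (j %% n) F p.
  by rewrite {1}(divn_eq j n) addnC iterD periodic_iterM.
have {si} : iter i.*2 F p = p.
  by apply: (@iter_drot_inj t); rewrite -iterD addnC (symmetric_return sp si).
rewrite -[in i.*2]addnn modE -modnDm -modE (modE i).
move: (ltn_pmod i n_gt0); set j := (i %% n)%N => j_lt ej.
have [->|j_gt0] := posnP j; [by left | right].
suff -> : j = n./2 by [].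
have n_le : (n <= j + j)%N by apply: n_min; rewrite addn_gt0 j_gt0 /=; apply/eqP.
(* As [j + j] is a period, [j + j - n] is a period or zero; it is below [n], so minimality forces it
   to vanish. *)
have : ~~ (0 < j + j - n)%N || (n <= j + j - n)%N.
  rewrite -implybE; apply/implyP => gt0; apply: n_min; rewrite gt0 /=.
  by apply/eqP; rewrite -[RHS]ej -[in RHS](subnK n_le) iterD per.
lia.
Qed.

End Symmetry.

(** * Escaping orbits and the decrease of a weight *)

Section Transport.
Variables (R : realDomainType) (T : eqType).

Lemma ler_sum_uniq_sub (s1 s2 : seq T) (g : T -> R) :
  uniq s1 -> uniq s2 -> (forall x, 0 <= g x) ->
  (forall x, x \in s1 -> 0 < g x -> x \in s2) ->
  \sum_(x <- s1) g x <= \sum_(x <- s2) g x.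
Proof.
move=> u1 u2 g_ge0 s12.
have e : perm_eq [seq x <- s1 | 0 < g x] [seq x <- s2 | (0 < g x) && (x \in s1)].
  apply: uniq_perm; rewrite ?filter_uniq // => x; rewrite !mem_filter.
  by have [gx|] //= := boolP (0 < g x); case: (boolP (x \in s1)) => //= /s12 ->.
rewrite (bigID (fun x => 0 < g x)) /= [X in _ + X]big1 ?addr0; last first.
  by move=> x; rewrite -leNgt => g_le0; apply/le_anti; rewrite g_le0 g_ge0.
rewrite -big_filter (perm_big _ e) /= big_filter.
by rewrite [leRHS](bigID (fun x => (0 < g x) && (x \in s1))) /= lerDl sumr_ge0.
Qed.

Variables (f : T -> T) (V : T -> R) (l : seq T) (B : T -> Prop).
Hypothesis f_inj : injective f.
Hypothesis l_uniq : uniq l.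
Hypothesis V_ge0 : forall z, 0 <= V z.
Hypothesis V_supp : forall z, 0 < V z -> z \in l.

Definition stays z := forall i, 0 < V (iter i f z).

(* Let [W] collect the initial segments in [{V > 0}] of the escaping orbits
   started in [B]. By [return_stays] and injectivity, [f @: W] meets [{V > 0}]
   inside [W] and outside its starting points, so these carry at most the loss
   of [V] along [f] on [W]. *)
Lemma escaping_bound :
  (forall z k, B z -> B (iter k.+1 f z) ->
     (forall j, (j <= k.+1)%N -> 0 < V (iter j f z)) -> stays z) ->
  \sum_(z <- l | `[< B z /\ ~ stays z >]) V z <=
    \sum_(z <- l) Num.max 0 (V z - V (f z)).
Proof.
move=> return_stays.
pose bad z := `[< B z /\ ~ stays z >] && (0 < V z).
pose W z := `[< exists s i, [/\ B s, ~ stays s,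
  (forall j, (j <= i)%N -> 0 < V (iter j f s)) & z = iter i f s] >].
have badW z : bad z -> W z.
  move=> /andP[/asboolP[Bz nz] Vz]; apply/asboolP; exists z, 0%N; split => // j.
  by rewrite leqn0 => /eqP ->.
have -> : \sum_(z <- l | `[< B z /\ ~ stays z >]) V z = \sum_(z <- l | bad z) V z.
  rewrite (bigID (fun z => 0 < V z)) /= [X in _ + X]big1 ?addr0 // => z.
  by rewrite -leNgt => /andP[_ V0]; apply/le_anti; rewrite V0 V_ge0.
have step : \sum_(z <- l | W z) V (f z) <= \sum_(z <- l | W z && ~~ bad z) V z.
  rewrite -[leRHS]big_filter -[leLHS]big_filter -(big_map f xpredT).
  apply: ler_sum_uniq_sub => //.
  - by rewrite map_inj_uniq // filter_uniq.
  - by rewrite filter_uniq.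
  move=> u /mapP[z]; rewrite mem_filter.
  move=> /andP[/asboolP[s [i [Bs ns sV ez]]] _] eu Vu.
  have eu' : u = iter i.+1 f s by rewrite eu ez.
  have sV' j : (j <= i.+1)%N -> 0 < V (iter j f s).
    by rewrite leq_eqVlt => /predU1P[->|/sV //]; rewrite -eu'.
  rewrite mem_filter V_supp // andbT; apply/andP; split.
    by apply/asboolP; exists s, (i.+1).
  apply/negP => /andP[/asboolP[Bu _] _]; apply: ns; rewrite eu' in Bu.
  exact: (return_stays s i Bs Bu sV').
have split : \sum_(z <- l | W z) V z =
    \sum_(z <- l | bad z) V z + \sum_(z <- l | W z && ~~ bad z) V z.
  rewrite (bigID bad) /=; congr (_ + _); apply: eq_bigl => z.
  by case: (boolP (bad z)) => [/badW ->|]; rewrite ?andbF.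
apply: (@le_trans _ _ (\sum_(z <- l | W z) (V z - V (f z)))).
  by rewrite sumrB split; lra.
rewrite big_mkcond; apply: ler_sum => z _; case: ifP => _.
  by rewrite le_max lexx orbT.
by rewrite le_max lexx.
Qed.

End Transport.

(** * Counting orbits by their symmetric points *)

Lemma size_undup_map (T U : eqType) (g : T -> U) (s : seq T) :
  uniq s ->
  (forall x, x \in s ->
     exists q, forall y, y \in s -> g y = g x -> y = x \/ y = q) ->
  (size s <= (size (undup (map g s))).*2)%N.
Proof.
move: {2}(size s) (leqnn (size s)) => n; elim: n s => [|n IH] [|x s] //= s_le.
move=> /andP[xs us] fib; have [|q qP] := fib x; first exact: mem_head.
pose s' := [seq y <- s | g y != g x].
have ps' : size s = (size s' + count (fun y => g y == g x) s)%N.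
  by rewrite size_filter addnC count_predC.
have cnt : (count (fun y => g y == g x) s <= 1)%N.
  rewrite -size_filter; apply: (@uniq_leq_size _ _ [:: q]); first exact: filter_uniq.
  move=> y; rewrite mem_filter inE => /andP[/eqP gy ys].
  have [||->] := qP y _ gy; rewrite ?inE ?ys ?orbT //.
  by move=> yx; rewrite -yx ys in xs.
have s'_le : (size s' <= (size (undup (map g s'))).*2)%N.
  apply: IH; [lia | exact: filter_uniq |].
  move=> y; rewrite mem_filter => /andP[_ ys].
  have [|z zP] := fib y; first by rewrite inE ys orbT.
  exists z => w; rewrite mem_filter => /andP[_ ws]; apply: zP.
  by rewrite inE ws orbT.
suff : (size (g x :: undup (map g s')) <= size (undup (map g (x :: s))))%N.
  by rewrite /=; lia.
apply: uniq_leq_size.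
  rewrite /= undup_uniq mem_undup andbT; apply/negP => /mapP[y].
  by rewrite mem_filter => /andP[/negP ne _] e; apply: ne; rewrite e.
move=> u; rewrite inE !mem_undup => /predU1P[->|/mapP[y]]; first exact: mem_head.
by rewrite mem_filter => /andP[_ ys] ->; apply: map_f; rewrite inE ys orbT.
Qed.

Lemma card_le_uniq (T : eqType) (s : seq T) (A : set T) :
  uniq s -> (forall x, x \in s -> A x) -> `I_(size s) #<= A.
Proof.
case: s => [|x0 s'] us sA; first by rewrite /= II0 card_ge0.
set s := x0 :: s' in us sA *.
apply: (@card_le_trans _ _ _ (nth x0 s @` `I_(size s))).
  suff : nth x0 s @` `I_(size s) #= `I_(size s) by rewrite card_eq_le => /andP[].
  apply: inj_card_eq => i j; rewrite !inE /= => i_lt j_lt /eqP.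
  by rewrite nth_uniq // => /eqP.
by apply: subset_card_le => _ [i /= i_lt <-]; apply: sA; rewrite mem_nth.
Qed.

Section Orbits.
Variables (R : realType) (lambda eta : R).
Local Notation F := (drot lambda eta).

Lemma bounded_periodic (l : seq (int * int)) p :
  (forall i, iter i F p \in l) -> drot_periodic lambda eta p.
Proof.
move=> pl; pose s := [seq iter i F p | i <- iota 0 (size l).+1].
have : ~~ uniq s.
  apply/negP => us; have := @uniq_leq_size _ s l us.
  rewrite size_map size_iota ltnn => abs; suff: false by [].
  by apply: abs => _ /mapP[i _ ->].
move=> /(uniqPn p)[i [j [ij]]]; rewrite size_map size_iota => j_lt.
have i_lt := ltn_trans ij j_lt.
rewrite !(nth_map 0%N) ?size_iota // !nth_iota // !add0n => e.
exists (j - i)%N; first by rewrite subn_gt0.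
by apply: (@iter_drot_inj _ lambda eta i); rewrite -iterD subnKC // ltnW.
Qed.

(** By [orbit_symmetric] an orbit contains at most two symmetric points of a given type, so there
    are at least half as many orbits as points. *)
Lemma orbits_of_symmetric_points (r : R) (t : bool) (s : seq (int * int)) :
  uniq s ->
  (forall p, p \in s -> [/\ symmetric lambda eta t p,
     drot_periodic lambda eta p & drot_orbit lambda eta p `<=` lattice_ball r]) ->
  exists n, (size s <= n.*2)%N /\ `I_n #<= periodic_orbits_within lambda eta r.
Proof.
move=> us sP; pose g := drot_orbit lambda eta.
exists (size (undup (map g s))); split.
  apply: size_undup_map => // p ps; have [symp perp _] := sP _ ps.
  have [q qP] := orbit_symmetric perp symp; exists q => y ys gy; apply: qP.
    by rewrite -[drot_orbit _ _ _]gy; exact: drot_orbit_refl.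
  by case: (sP _ ys).
apply: card_le_uniq; first exact: undup_uniq.
by move=> O; rewrite mem_undup => /mapP[p ps ->]; exists p; have [] := sP _ ps.
Qed.

End Orbits.

(** * Parity and fractional parts of a Beatty sequence *)

Section Approximation.
Variables (R : realType) (lambda eta : R).

Definition beatty (y : int) : int := Num.floor (lambda * y%:~R + eta).

Definition beatty_frac (y : int) : R :=
  lambda * y%:~R + eta - (beatty y)%:~R.

Lemma beatty_frac_itv y : 0 <= beatty_frac y < 1.
Proof.
have /andP[] := floor_itv (lambda * y%:~R + eta).
by rewrite /beatty_frac /beatty intrD1; lra.
Qed.

Lemma remainder (x g : R) : 0 < g ->
  exists k : int, 0 <= x - k%:~R * g < g.
Proof.
move=> g_gt0; exists (Num.floor (x / g)).
have /andP[] := floor_itv (x / g).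
by rewrite intrD1 ler_pdivlMr // ltr_pdivrMr //; lra.
Qed.

(** The group [lambda * Z + 2 * Z]; the generator 2 is there because [beatty] matters modulo 2. *)
Let span (g : R) : Prop := exists a b : int, g = lambda * a%:~R + 2 * b%:~R.

Let spanB (g x : R) (k : int) : span g -> span x -> span (x - k%:~R * g).
Proof.
move=> [a [b ->]] [c [d ->]]; exists (c - k * a), (d - k * b).
by rewrite !rmorphB !rmorphM /=; ring.
Qed.

Let span_half (g x : R) : span g -> 0 < g -> span x ->
  (exists k : int, x = k%:~R * g) \/ (exists2 g', span g' & 0 < g' <= g / 2).
Proof.
move=> sg g_gt0 sx; have [k /andP[r_ge0 r_lt]] := remainder x g_gt0.
have sr : span (x - k%:~R * g) by exact: spanB.
have [r0|rN0] := eqVneq (x - k%:~R * g) 0.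
  by left; exists k; apply/eqP; rewrite -subr_eq0 r0.
have r_gt0 : 0 < x - k%:~R * g by rewrite lt_neqAle eq_sym rN0.
right; have [le|gt] := lerP (x - k%:~R * g) (g / 2).
  by exists (x - k%:~R * g); rewrite ?r_gt0.
exists (g - 1%:~R * (x - k%:~R * g)); first exact: spanB.
by rewrite mul1r; lra.
Qed.

(* The Euclidean algorithm on [2] and [lambda]. *)
Let span_small_or_cyclic (k : nat) :
  (exists2 g, span g & 0 < g <= 2 / (2 ^ k)%:R) \/
  (exists g (n a : int), [/\ span g, 0 < g, 2 = n%:~R * g & lambda = a%:~R * g]).
Proof.
have s2 : span 2 by exists 0, 1; rewrite mulr0 add0r mulr1.
have sl : span lambda by exists 1, 0; rewrite mulr0 addr0 mulr1.
elim: k => [|k [[g sg /andP[g_gt0 g_le]]|]]; last by right.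
  by left; exists 2 => //; rewrite expn0; lra.
have half g' : g' <= g / 2 -> g' <= 2 / (2 ^ k.+1)%:R.
  move=> g'_le; rewrite expnS natrM invfM mulrCA; lra.
have [[n en]|[g' sg' /andP[g'_gt0 /half g'_le]]] := span_half sg g_gt0 s2; last first.
  by left; exists g'; rewrite ?g'_gt0.
have [[a ea]|[g' sg' /andP[g'_gt0 /half g'_le]]] := span_half sg g_gt0 sl; last first.
  by left; exists g'; rewrite ?g'_gt0.
by right; exists g, n, a.
Qed.

(* If [lambda * Z + 2 * Z] is dense then [e] can be made small, and
   [kappa = 1 / 2] works. Otherwise it is generated by [g = 2 / n]; for even
   [n] one can take [e = 0], and for odd [n] one takes [e = 1 / n], while the
   values of [beatty_frac] lie in an interval of length [1 - 1 / n]. *)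
Lemma approximation (delta : R) : 0 < delta ->
  exists (kappa e : R) (h o : int),
    [/\ 0 <= e <= 1, lambda * h%:~R = 2 * o%:~R + 1 + e &
      forall y, `|kappa - beatty_frac y| <= (1 - e) / 2 + delta].
Proof.
move=> delta_gt0.
have int_ge0 (j : int) : -1 < j -> 0 <= j by lia.
have int_leB1 (j k : int) : j < k -> j <= k - 1 by lia.
have half e y : e <= 2 * delta -> `|2^-1 - beatty_frac y| <= (1 - e) / 2 + delta.
  by move=> e_le; have := beatty_frac_itv y; rewrite ler_norml; lra.
pose b := Num.min 1 (2 * delta).
have b_gt0 : 0 < b by rewrite lt_min; lra.
have [k k_gt] : exists k : nat, 2 / b < k%:R.
  by exists (Num.truncn (2 / b)).+1; rewrite truncnS_gt.
have [[g [a [c eg]] /andP[g_gt0 g_le]]|] := span_small_or_cyclic k.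
  have g_le_b : g <= b.
    apply: le_trans g_le _; rewrite ler_pdivrMr ?ltr0n ?expn_gt0 //.
    rewrite mulrC -ler_pdivrMr // (le_trans (ltW k_gt)) // ler_nat.
    by rewrite ltnW // ltn_expl.
  move: g_le_b; rewrite le_min => /andP[g_le1 g_led].
  have [q] := remainder 1 g_gt0; set qg := _ * g => q_itv.
  (* [qg + g] is the first multiple of [g] beyond 1, and it overshoots 1 by at most [g <= b]. *)
  exists 2^-1, (qg + g - 1), ((q + 1) * a), (- ((q + 1) * c)); split.
  - lra.
  - by rewrite /qg eg !rmorphN !rmorphM !rmorphD /=; ring.
  - by move=> y; apply: half; lra.
move=> [g [n [a [[c [d eg]] g_gt0 en el]]]].
have n_gt0 : 0 < n.
  by rewrite -(ltr_int R); have : 0 < n%:~R * g by [rewrite -en]; rewrite pmulr_lgt0.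
have [p np] : exists p : nat, n = p%:Z by exists `|n|%N; lia.
rewrite {n}np in en n_gt0.
have [/= odd_p|even_p] := boolP (odd p); last first.
  have ep : (p%:Z)%:~R = 2 * (p./2%:Z)%:~R :> R.
    by rewrite -[2]/(2%:~R) -intrM; congr (_%:~R); lia.
  exists 2^-1, 0, (p./2%:Z * c), (- (p./2%:Z * d)); split.
  - by lra.
  - rewrite ep in en; rewrite !rmorphN !rmorphM /=.
    have : 1 = (p./2%:Z)%:~R * g by lra.
    by rewrite eg; lra.
  - by move=> y; apply: half; lra.
have p_gt0 : 0 < p%:R :> R by rewrite ltr0n; lia.
have eg2 : g = 2 / p%:R by rewrite en; field; lra.
have ep : p%:R = 2 * (p./2)%:R + 1 :> R.
  by rewrite -[in RHS]natrM natr1; congr (_%:R); lia.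
pose z := p%:R * eta - (Num.floor (p%:R * eta))%:~R : R.
have z_itv : 0 <= z < 1.
  by have /andP[] := floor_itv (p%:R * eta); rewrite /z intrD1; lra.
(* The values of [beatty_frac] are among [(j + z) / p] with [0 <= j < p], and [kappa] is the
   midpoint of these. The multiple [p./2 + 1] of [g] is [1 + 1 / p]. *)
exists ((z + (p%:R - 1) / 2) / p%:R), (p%:R^-1),
  ((p./2%:Z + 1) * c), (- ((p./2%:Z + 1) * d)); split.
- rewrite invr_ge0 ltW //= invf_le1 // ler1n; lia.
- have : (p./2%:R + 1) * g = 1 + p%:R^-1.
    by rewrite eg2 ep; field; rewrite -ep; lra.
  rewrite eg !rmorphN !rmorphM !rmorphD /= -!pmulrn; lra.
move=> y; set w := beatty_frac y.
have w_itv := beatty_frac_itv y; rewrite -/w in w_itv.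
pose j : int := 2 * (a * y) + Num.floor (p%:R * eta) - p%:Z * beatty y.
have ej : p%:R * w = j%:~R + z.
  rewrite /j /w /beatty_frac /z el eg2 !rmorphB !rmorphD !rmorphM /=.
  by rewrite -!pmulrn; field; lra.
have pw : 0 <= p%:R * w < p%:R.
  by rewrite mulr_ge0 ?(ltW p_gt0) //= ?gtr_pMr //; lra.
have j_ge0 : 0 <= j.
  have : -1 < j%:~R :> R by lra.
  by rewrite -[-1]/((-1)%:~R) ltr_int => /int_ge0.
have j_lt : j <= p%:Z - 1.
  have : j%:~R < p%:Z%:~R :> R by rewrite -!pmulrn; lra.
  by rewrite ltr_int => /int_leB1.
have j_ge0' : 0 <= j%:~R :> R by rewrite ler0z.
have j_lt' : j%:~R <= p%:R - 1 :> R.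
  have <- : (p%:Z - 1)%:~R = p%:R - 1 :> R by rewrite rmorphB.
  by rewrite ler_int.
have -> : w = (j%:~R + z) / p%:R by rewrite -ej mulrC mulKf ?gt_eqF.
have -> : (z + (p%:R - 1) / 2) / p%:R - (j%:~R + z) / p%:R =
  ((p%:R - 1) / 2 - j%:~R) / p%:R by field; lra.
have -> : (1 - p%:R^-1) / 2 = ((p%:R - 1) / 2) / p%:R :> R by field; lra.
rewrite normrM (ger0_norm (ltW _ : 0 <= p%:R^-1)) ?invr_gt0 //.
apply: (@le_trans _ _ ((p%:R - 1) / 2 / p%:R)); last by lra.
rewrite ler_pM2r ?invr_gt0 // ler_norml; lra.
Qed.

Definition beatty_even (y : int) : R := (~~ odd `|beatty y|)%:R.

(** Moving by [h] raises the argument of the floor by [2 * o + 1 + e]. Without a carry the parity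
    flips and the expression vanishes; with one the parity is kept and it equals
    [2 * beatty_even y]. On average, even values thus have frequency at least [(1 - e) / 2]. *)
Lemma beatty_even_shift (e : R) (h o y : int) :
  0 <= e <= 1 -> lambda * h%:~R = 2 * o%:~R + 1 + e ->
  0 <= beatty_even y + beatty_even (y + h) - 1 + e
       + beatty_frac y - beatty_frac (y + h).
Proof.
move=> e_itv eh; have w_itv := beatty_frac_itv y.
have ey : lambda * (y + h)%:~R + eta =
    (beatty y + 2 * o + 1)%:~R + (beatty_frac y + e).
  by rewrite /beatty_frac !rmorphD rmorphM /= mulrDr eh; lra.
rewrite [beatty_frac (y + h)]/beatty_frac.
have [lt1|ge1] := ltrP (beatty_frac y + e) 1.
  have eb : beatty (y + h) = beatty y + 2 * o + 1.
    by apply: floor_def; rewrite ey intrD1; lra.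
  have -> : beatty_even (y + h) = 1 - beatty_even y.
    rewrite /beatty_even eb; have -> : odd `|beatty y + 2 * o + 1| = ~~ odd `|beatty y| by lia.
    by case: odd; rewrite /=; lra.
  by rewrite eb ey; lra.
have eb : beatty (y + h) = beatty y + 2 * o + 2.
  by apply: floor_def; rewrite ey !rmorphD /=; lra.
have -> : beatty_even (y + h) = beatty_even y.
  by rewrite /beatty_even eb; have -> : odd `|beatty y + 2 * o + 2| = odd `|beatty y| by lia.
have : 0 <= beatty_even y by rewrite ler0n.
by rewrite eb ey !rmorphD /=; lra.
Qed.

End Approximation.

(** * Sums over integer intervals symmetric about 0 *)

Definition zrange (K : nat) : seq int :=
  [seq i%:Z - K%:Z | i <- iota 0 (K.*2.+1)].

Lemma zrange_uniq K : uniq (zrange K).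
Proof. by rewrite map_inj_uniq ?iota_uniq // => i j; lia. Qed.

Lemma size_zrange K : size (zrange K) = K.*2.+1.
Proof. by rewrite size_map size_iota. Qed.

Lemma mem_zrange K x : (x \in zrange K) = (absz x <= K)%N.
Proof.
apply/mapP/idP => [[i]|x_le]; first by rewrite mem_iota => i_lt ->; lia.
by exists (absz (x + K%:Z)); [rewrite mem_iota; lia | lia].
Qed.

Section IntegerSums.
Variable R : realType.
Implicit Type g : int -> R.

Lemma zrange_telescope K g :
  \sum_(x <- zrange K) (g (x + 1) - g x) = g (K%:Z + 1) - g (- K%:Z).
Proof.
rewrite big_map -[iota _ _]/(index_iota 0 K.*2.+1).
rewrite (@telescope_sumr_eq _ _ _ (fun i => g (i%:Z - K%:Z))) //.
  by congr (g _ - g _); lia.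
by move=> k _; congr (g _ - _); lia.
Qed.

Lemma zrange_opp K g :
  \sum_(x <- zrange K) g (- x) = \sum_(x <- zrange K) g x.
Proof.
rewrite -(big_map -%R xpredT); apply: perm_big; apply: uniq_perm.
- by rewrite map_inj_uniq ?zrange_uniq //; exact: oppr_inj.
- exact: zrange_uniq.
move=> x; apply/mapP/idP => [[y]|]; rewrite !mem_zrange => xK.
  by move=> ->; lia.
by exists (- x); rewrite ?mem_zrange ?opprK //; lia.
Qed.

Lemma zrange_le_cst K g (b : R) :
  (forall x, (absz x <= K)%N -> g x <= b) ->
  \sum_(x <- zrange K) g x <= K.*2.+1%:R * b.
Proof.
move=> gb; rewrite -(size_zrange K) mulr_natl.
have -> : b *+ size (zrange K) = \sum_(x <- zrange K) b.
  by rewrite big_const_seq count_predT iter_addr_0.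
by rewrite !big_seq; apply: ler_sum => x; rewrite mem_zrange => /gb.
Qed.

Lemma zrange_norm_le_cst K g (b : R) :
  (forall x, (absz x <= K)%N -> `|g x| <= b) ->
  `|\sum_(x <- zrange K) g x| <= K.*2.+1%:R * b.
Proof. by move=> gb; apply: le_trans (ler_norm_sum _ _ _) (zrange_le_cst gb). Qed.

(** Summation by parts: a unit shift costs [2 * M] at the two ends and [b] for each term, and a
    shift by [h] is made of [|h|] unit shifts. *)
Lemma zrange_shift K (tau : int -> R) (M b : R) (h : int) :
  (forall y, 0 <= tau y <= M) ->
  (forall y, (absz y <= K)%N -> `|tau (y + 1) - tau y| <= b) ->
  forall g, (forall y, `|g y| <= 1) ->
  `|\sum_(y <- zrange K) tau y * (g (y + h) - g y)|
    <= `|h|%:~R * (2 * M + K.*2.+1%:R * b).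
Proof.
move=> tauM tau_lip.
have step g : (forall y, `|g y| <= 1) ->
    `|\sum_(y <- zrange K) tau y * (g (y + 1) - g y)| <= 2 * M + K.*2.+1%:R * b.
  move=> g_le1.
  have tg y : `|tau y * g y| <= M.
    have /andP[t_ge0 t_leM] := tauM y.
    by rewrite normrM ger0_norm // -[leRHS]mulr1 ler_pM.
  have -> : \sum_(y <- zrange K) tau y * (g (y + 1) - g y) =
      \sum_(y <- zrange K) (tau (y + 1) * g (y + 1) - tau y * g y)
      - \sum_(y <- zrange K) (tau (y + 1) - tau y) * g (y + 1).
    by rewrite -sumrB; apply: eq_bigr => y _; ring.
  rewrite (zrange_telescope K (fun y => tau y * g y)).
  apply: le_trans (ler_normB _ _) _; apply: lerD.
    by apply: le_trans (ler_normB _ _) _; rewrite mulr2n mulrDl mul1r lerD.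
  apply: zrange_norm_le_cst => y yK.
  by rewrite normrM -[leRHS]mulr1 ler_pM // tau_lip.
have shift_nat (n : nat) g : (forall y, `|g y| <= 1) ->
    `|\sum_(y <- zrange K) tau y * (g (y + n%:Z) - g y)| <= n%:R * (2 * M + K.*2.+1%:R * b).
  move=> g_le1; elim: n => [|n IH].
    rewrite mul0r big1 ?normr0 // => y _.
    by rewrite addr0 subrr mulr0.
  have -> : \sum_(y <- zrange K) tau y * (g (y + n.+1%:Z) - g y) =
      \sum_(y <- zrange K) tau y * (g (y + n%:Z) - g y) +
      \sum_(y <- zrange K) tau y * (g (y + 1 + n%:Z) - g (y + n%:Z)).
    rewrite -big_split; apply: eq_bigr => y _ /=.
    by rewrite (_ : y + n.+1 = y + 1 + n) ; [ring | lia].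
  apply: le_trans (ler_normD _ _) _; rewrite -natr1 mulrDl mul1r lerD //.
  exact: (step (fun y => g (y + n%:Z))).
move=> g g_le1; have [h_ge0|h_lt0] := leP 0 h.
  have [n ->] : exists n : nat, h = n%:Z by exists (absz h); lia.
  exact: shift_nat.
have [n ->] : exists n : nat, h = - n%:Z by exists (absz h); lia.
rewrite normrN -[leLHS]normrN -sumrN.
have -> : \sum_(y <- zrange K) - (tau y * (g (y - n%:Z) - g y)) =
    \sum_(y <- zrange K) tau y * (g (y + n%:Z - n%:Z) - g (y - n%:Z)).
  by apply: eq_bigr => y _; rewrite addrK; ring.
have -> : \sum_(y <- zrange K) tau y * (g (y + n%:Z - n%:Z) - g (y - n%:Z)) =
    \sum_(y <- zrange K) tau y * ((fun y => g (y - n%:Z)) (y + n%:Z) - (fun y => g (y - n%:Z)) y).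
  by [].
exact: shift_nat.
Qed.

End IntegerSums.

(** * Decrease of a truncated parabola along a row *)

Section RowVariation.
Variable R : realType.

Definition clipped_square (b x : R) : R := Num.min (Num.max 0 x ^+ 2) b.

Lemma clipped_square_itv (b x : R) : 0 <= b -> 0 <= clipped_square b x <= b.
Proof. by move=> b_ge0; rewrite /clipped_square le_min sqr_ge0 b_ge0 ge_min lexx orbT. Qed.

Lemma clipped_square_mono (b x y : R) :
  x <= y -> clipped_square b x <= clipped_square b y.
Proof.
move=> xy; have max_le : Num.max 0 x <= Num.max 0 y.
  by rewrite ge_max !le_max lexx xy orbT.
have pos (z : R) : 0 <= Num.max 0 z by rewrite le_max lexx.
rewrite /clipped_square le_min !ge_min lexx orbT andbT; apply/orP; left.
by rewrite ler_sqr ?nnegrE.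
Qed.

(** The parabola drops by [d * (2 * x + d)], which for [0 <= x] is at most [d] times the unit
    increment of the square. Clipping keeps the telescoped increments below [b], and [b] is so large
    that the upper clip is inactive where the parabola is positive. *)
Lemma parabola_variation (T L d x b : R) :
  0 <= L -> T <= L ^+ 2 -> 0 <= d <= 1 -> b = Num.max 0 T + 2 * L + 1 ->
  Num.max 0 (Num.max 0 (T - x ^+ 2) - Num.max 0 (T - (x + d) ^+ 2))
    <= d * (clipped_square b (x + 1) - clipped_square b x).
Proof.
move=> L_ge0 T_le d_itv b_def.
have mono : clipped_square b x <= clipped_square b (x + 1).
  by apply: clipped_square_mono; lra.
have [d_ge0 d_le1] := andP d_itv.
rewrite ge_max; apply/andP; split.
  by rewrite mulr_ge0 // subr_ge0.
have [T_le0|T_gt] := lerP (T - x ^+ 2) 0.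
  apply: (@le_trans _ _ 0); first by rewrite sub0r oppr_le0 le_max lexx.
  by rewrite mulr_ge0 // subr_ge0.
have x2_ge0 := sqr_ge0 x.
have {}b_def : b = T + 2 * L + 1 by rewrite b_def max_r //; lra.
apply: (@le_trans _ _ (d * (2 * x + d))).
  have : T - (x + d) ^+ 2 <= Num.max 0 (T - (x + d) ^+ 2) by rewrite le_max lexx orbT.
  by lra.
apply: ler_wpM2l => //; rewrite /clipped_square.
have x_ltL : `|x| < L by rewrite -(ltr_pXn2r (n := 2)) ?nnegrE // real_normK ?num_real //; lra.
move: x_ltL; rewrite ltr_norml => /andP[_ x_ltL].
have [x_ge0|x_lt0] := lerP 0 x.
  rewrite (max_r (_ : 0 <= x + 1)); last by lra.
  by rewrite !min_l; lra.
rewrite expr0n /= (min_l (_ : 0 <= b)); last by lra.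
have [x1_le0|x1_gt0] := lerP (x + 1) 0.
  by rewrite expr0n /= min_l; lra.
rewrite min_l; last by nra.
by lra.
Qed.

(** Inside the square, the reflection with defect [d] acts as a translation by [d], and the bounds
    of [parabola_variation] telescope along the row. *)
Lemma row_variation (K : nat) (T L d a : R) :
  0 <= L -> T <= L ^+ 2 -> `|d| <= 1 ->
  \sum_(x <- zrange K)
    Num.max 0 (Num.max 0 (T - (x%:~R - a) ^+ 2)
               - Num.max 0 (T - (- (x%:~R - a) - d) ^+ 2))
    <= `|d| * (Num.max 0 T + 2 * L + 1).
Proof.
move=> L_ge0 T_le d_le1; set b := _ + 1.
have b_ge0 : 0 <= b.
  have : 0 <= Num.max 0 T by rewrite le_max lexx.
  by rewrite /b; lra.
have tel s : \sum_(x <- zrange K) `|d| *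
    (clipped_square b (x%:~R - s + 1) - clipped_square b (x%:~R - s)) <= `|d| * b.
  rewrite -mulr_sumr; apply: ler_wpM2l => //.
  have -> : \sum_(x <- zrange K)
      (clipped_square b (x%:~R - s + 1) - clipped_square b (x%:~R - s)) =
      \sum_(x <- zrange K) ((fun x => clipped_square b (x%:~R - s)) (x + 1)
        - (fun x => clipped_square b (x%:~R - s)) x).
    by apply: eq_bigr => x _; rewrite rmorphD /= addrAC.
  rewrite (zrange_telescope K (fun x => clipped_square b (x%:~R - s))).
  have := clipped_square_itv (K%:Z + 1)%:~R b_ge0.
  set u := (_ + 1)%:~R - s; set v := (- _)%:~R - s.
  have := clipped_square_itv u b_ge0; have := clipped_square_itv v b_ge0; lra.
have [d_ge0|d_lt0] := lerP 0 d.
  apply: le_trans (tel a); apply: ler_sum => x _.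
  rewrite -opprD sqrrN ger0_norm //; apply: (@parabola_variation T L) => //.
  by move: d_le1; rewrite ger0_norm // => ->; rewrite d_ge0.
(* For negative [d], reversing the row replaces [d] and [a] by their opposites. *)
rewrite -(zrange_opp K) /=; apply: le_trans (tel (- a)); apply: ler_sum => x _.
rewrite rmorphN /= -[- x%:~R - a]opprD !sqrrN opprK ltr0_norm //.
rewrite [x%:~R + a - d]/(x%:~R + a + - d) opprK.
apply: (@parabola_variation T L) => //.
by move: d_le1; rewrite ltr0_norm // => ->; rewrite oppr_ge0 ltW.
Qed.

End RowVariation.

(** * The quadratic weight and its row estimates *)

Section Weight.
Variables (R : realType) (lambda eta kappa c L : R).

Local Notation F := (drot lambda eta).
Local Notation m := (beatty lambda eta).
Local Notation w := (beatty_frac lambda eta).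
Local Notation even := (beatty_even lambda eta).
Local Notation ellipticity := (1 - lambda ^+ 2 / 4).

Definition row_center (y : int) : R := c - lambda / 2 * (y%:~R - c).

Definition row_height (y : int) : R :=
  L ^+ 2 - ellipticity * (y%:~R - c) ^+ 2.

(* The positive part of [L ^ 2 - (X ^ 2 + lambda * X * Y + Y ^ 2)], where
   [(X, Y) = (x - c, y - c)], after completing the square in [X]. *)
Definition weight (p : int * int) : R :=
  Num.max 0 (row_height p.2 - (p.1%:~R - row_center p.2) ^+ 2).

Definition row_weight (y : int) : R := Num.max 0 (row_height y).

Lemma weight_ge0 p : 0 <= weight p.
Proof. by rewrite le_max lexx. Qed.

Lemma weight_swap p : weight (swap p) = weight p.
Proof.
case: p => x y; rewrite /weight /row_height /row_center /=; congr Num.max.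
by field.
Qed.

Lemma row_weight_ge0 y : 0 <= row_weight y.
Proof. by rewrite le_max lexx. Qed.

(** The condition on [c] amounts to [2 * row_center y + m y = kappa - w y], the amount by which the
    reflection [x |-> - x - m y] fails to preserve the axis of row [y]. *)
Lemma weight_drot x y : (2 + lambda) * c = kappa - eta ->
  weight (F (x, y)) = Num.max 0
    (row_height y - (- (x%:~R - row_center y) - (kappa - w y)) ^+ 2).
Proof.
move=> c_def.
rewrite -weight_swap drotE /weight /=; congr (Num.max 0 (_ - _ ^+ 2)).
have -> : kappa = (2 + lambda) * c + eta by rewrite c_def subrK.
by rewrite -/(m y) /beatty_frac /row_center rmorphB rmorphN /=; field.
Qed.

Lemma symmetric_diagonal (x : int) : symmetric lambda eta false (x, x).
Proof. by []. Qed.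

(** The row reflection [x |-> - x - m y] fixes the integer [- m y / 2] when [m y] is even; the
    coordinates are exchanged to match [symmetric]. *)
Lemma symmetric_even y : ~~ odd (absz (m y)) ->
  symmetric lambda eta true (y, - (m y %/ 2)%Z).
Proof.
move=> m_even; rewrite /symmetric /= drotE /swap /=; congr pair.
by rewrite -/(m y) opprK; lia.
Qed.

(** After the swap, the point is at distance [|kappa - w y| / 2] from the axis of row [y], which
    costs at most 1 of the maximal weight. *)
Lemma weight_even y : (2 + lambda) * c = kappa - eta ->
  `|kappa - w y| <= 1 -> ~~ odd (absz (m y)) ->
  row_weight y - 1 <= weight (y, - (m y %/ 2)%Z).
Proof.
move=> c_def kappa_le1 m_even; rewrite -weight_swap /weight /=.
have e : (m y)%:~R = 2 * (m y %/ 2)%Z%:~R :> R.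
  by rewrite -[2]/(2%:~R) -intrM; congr (_%:~R); lia.
have -> : (- (m y %/ 2)%Z)%:~R - row_center y = - ((kappa - w y) / 2).
  have -> : kappa = (2 + lambda) * c + eta by rewrite c_def subrK.
  by rewrite rmorphN /= /row_center /beatty_frac e; field.
have : ((kappa - w y) / 2) ^+ 2 <= 1.
  by move: kappa_le1; rewrite ler_norml; nra.
rewrite sqrrN; set u := _ ^+ 2 => u_le1.
rewrite /row_weight; case: (lerP 0 (row_height y)) => h; last first.
  by rewrite (@le_trans _ _ 0) ?le_max ?lexx //; lra.
by apply: (@le_trans _ _ (row_height y - u)); rewrite ?le_max ?lexx ?orbT //; lra.
Qed.

Lemma even_sum (K : nat) : (2 + lambda) * c = kappa - eta ->
  (forall y, `|kappa - w y| <= 1) ->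
  \sum_(y <- zrange K) even y * row_weight y - K.*2.+1%:R <=
  \sum_(y <- zrange K | ~~ odd (absz (m y))) weight (y, - (m y %/ 2)%Z).
Proof.
move=> c_def kappa_le1.
rewrite lerBlDr [X in _ <= X + _]big_mkcond /=.
have -> : K.*2.+1%:R = \sum_(y <- zrange K) (1 : R).
  by rewrite big_const_seq count_predT iter_addr_0 size_zrange.
rewrite -big_split; apply: ler_sum => y _ /=; rewrite /beatty_even.
case: ifPn => [m_even|]; last by rewrite mul0r add0r.
by rewrite mul1r -lerBlDr weight_even.
Qed.

Hypothesis lambda_itv : -2 < lambda < 2.

Lemma ellipticity_itv : 0 < ellipticity <= 1.
Proof.
have := sqr_ge0 lambda.
have [lo hi] := andP lambda_itv.
have : 0 < (2 - lambda) * (2 + lambda) by apply: mulr_gt0; lra.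
by lra.
Qed.

Lemma row_height_le y : row_height y <= L ^+ 2.
Proof.
have := sqr_ge0 (y%:~R - c : R); have /andP[+ _] := ellipticity_itv.
by rewrite /row_height => A_gt0 s_ge0; rewrite gerBl mulr_ge0 // ltW.
Qed.

Lemma row_weight_le y : row_weight y <= L ^+ 2.
Proof. by rewrite /row_weight ge_max sqr_ge0 row_height_le. Qed.

Lemma weight_le p : weight p <= L ^+ 2.
Proof.
rewrite /weight ge_max sqr_ge0 /=; apply: le_trans (row_height_le p.2).
by rewrite gerBl sqr_ge0.
Qed.

Lemma weight_supp_snd p : 0 <= L -> 0 < weight p ->
  `|p.2%:~R| <= L / ellipticity + `|c|.
Proof.
move=> L_ge0; have /andP[] := ellipticity_itv.
set A := ellipticity => A_gt0 A_le1.
rewrite lt_max ltxx /= /row_height -/A => V_gt0.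
have s_ge0 := sqr_ge0 (p.1%:~R - row_center p.2).
(* As [A <= 1], the factor [A] can stand in for [sqrt A], which gives a weaker bound free of square
   roots. *)
have AY : (A * (p.2%:~R - c)) ^+ 2 <= L ^+ 2.
  rewrite exprMn; have := sqr_ge0 (p.2%:~R - c); set Y := _ ^+ 2 => Y_ge0.
  have A2_le : A ^+ 2 <= A by rewrite expr2 ler_piMl // ltW.
  have := ler_wpM2r Y_ge0 A2_le; rewrite -/Y in V_gt0; lra.
have AY' : `|p.2%:~R - c| <= L / A.
  rewrite ler_pdivlMr // mulrC -[A in leLHS]gtr0_norm // -normrM.
  by rewrite -(ler_pXn2r (n := 2)) ?nnegrE // real_normK ?num_real.
have -> : p.2%:~R = (p.2%:~R - c) + c by rewrite subrK.
by apply: le_trans (ler_normD _ _) _; rewrite lerD2r.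
Qed.

Lemma weight_supp p : 0 <= L -> 0 < weight p ->
  `|p.1%:~R| <= L / ellipticity + `|c| /\ `|p.2%:~R| <= L / ellipticity + `|c|.
Proof.
move=> L_ge0 Vp; split; last exact: weight_supp_snd.
by apply: (@weight_supp_snd (swap p)); rewrite ?weight_swap.
Qed.

(** On the diagonal the form is [(2 + lambda) * (x - c) ^ 2], at most [L ^ 2 / 4] for
    [|x| <= L / 8]. There are at least [L / 8] such points, each of weight at least [L ^ 2 / 2]. *)
Lemma diagonal_sum (K : nat) : 8 <= L -> 8 * `|c| <= L -> L <= K%:R ->
  L ^+ 3 / 16 <= \sum_(x <- zrange K) weight (x, x).
Proof.
move=> L_ge8 c_le K_ge; have [lo hi] := andP lambda_itv.
have L8_ge0 : 0 <= L / 8 by lra.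
pose k := Num.truncn (L / 8).
have /andP[k_le] := truncn_itv L8_ge0; rewrite -/k in k_le *; rewrite -[k.+1%:R]natr1 => k_gt.
have kK : (k <= K)%N by rewrite -(ler_nat R); lra.
apply: (@le_trans _ _ (\sum_(x <- zrange k) L ^+ 2 / 2)).
  rewrite big_const_seq count_predT iter_addr_0 size_zrange -[leRHS]mulr_natl.
  have -> : k.*2.+1%:R = 2 * k%:R + 1 :> R by rewrite -[LHS]natr1 -muln2 natrM mulrC.
  have := sqr_ge0 L; rewrite [L ^+ 3]exprSr; set s := L ^+ 2 => s_ge0; nra.
apply: (@le_trans _ _ (\sum_(x <- zrange k) weight (x, x))); last first.
  apply: ler_sum_uniq_sub; rewrite ?zrange_uniq // => x; first exact: weight_ge0.
  by rewrite !mem_zrange => xk _; exact: leq_trans xk kK.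
rewrite !big_seq; apply: ler_sum => x; rewrite mem_zrange => xk.
have xk' : `|x%:~R| <= k%:R :> R by rewrite -intr_norm -abszE -pmulrn ler_nat.
have xc : `|x%:~R - c| <= L / 4.
  by apply: le_trans (ler_normB _ _) _; lra.
apply: (@le_trans _ _ (L ^+ 2 - (2 + lambda) * (x%:~R - c) ^+ 2)); last first.
  rewrite /weight le_max; apply/orP; right; rewrite /row_height /row_center /=.
  by rewrite le_eqVlt; apply/orP; left; apply/eqP; field.
have : (x%:~R - c) ^+ 2 <= (L / 4) ^+ 2.
  by rewrite -real_normK ?num_real // ler_sqr ?nnegrE //; lra.
have := sqr_ge0 (x%:~R - c); set s := _ ^+ 2 => s_ge0.
have : (2 + lambda) * s <= 4 * s by rewrite ler_wpM2r //; lra.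
by have := sqr_ge0 L; rewrite expr_div_n; lra.
Qed.

Lemma variation_bound (K : nat) : (2 + lambda) * c = kappa - eta ->
  (forall y, `|kappa - w y| <= 1) -> 0 <= L ->
  \sum_(p <- [seq (x, y) | x <- zrange K, y <- zrange K])
    Num.max 0 (weight p - weight (F p)) <=
  \sum_(y <- zrange K) `|kappa - w y| * row_weight y
    + K.*2.+1%:R * (2 * L + 1).
Proof.
move=> c_def kappa_le1 L_ge0.
rewrite big_allpairs exchange_big /=.
apply: (@le_trans _ _ (\sum_(y <- zrange K)
  (`|kappa - w y| * row_weight y + (2 * L + 1)))).
  apply: ler_sum => y _; under eq_bigr do rewrite weight_drot //.
  apply: (@le_trans _ _ (`|kappa - w y| * (row_weight y + 2 * L + 1))).
    rewrite /weight /row_weight /=.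
    exact: (row_variation K (row_center y) L_ge0 (row_height_le y) (kappa_le1 y)).
  rewrite -addrA mulrDr lerD2l -[leRHS]mul1r ler_wpM2r ?kappa_le1 //.
  by lra.
by rewrite big_split lerD2l; exact: zrange_le_cst.
Qed.

End Weight.

(** * Excess of the symmetric weight over the decrease *)

Section Surplus.
Variables (R : realType) (lambda eta kappa c L : R).

Local Notation F := (drot lambda eta).
Local Notation m := (beatty lambda eta).
Local Notation w := (beatty_frac lambda eta).
Local Notation even := (beatty_even lambda eta).
Local Notation row_weight := (row_weight lambda c L).
Local Notation weight := (weight lambda c L).

Lemma row_weight_lipschitz K y : -2 < lambda < 2 -> (absz y <= K)%N ->
  `|row_weight (y + 1) - row_weight y| <= 2 * K%:R + 2 * `|c| + 1.
Proof.
move=> lambda_itv yK; have /andP[A_gt0 A_le1] := ellipticity_itv lambda_itv.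
have max_lip (u v : R) : `|Num.max 0 u - Num.max 0 v| <= `|u - v|.
  wlog uv : u v / u <= v.
    move=> H; case/orP: (le_total u v) => [/H //|/H].
    by rewrite distrC [leRHS]distrC.
  have [v_le0|v_gt0] := lerP v 0.
    by rewrite !max_l ?(le_trans uv) // subrr normr0.
  have [u_le0|u_gt0] := lerP u 0.
    by rewrite sub0r normrN gtr0_norm // distrC ger0_norm; lra.
  by [].
apply: le_trans (max_lip _ _) _; rewrite /row_height.
set A := (1 - lambda ^+ 2 / 4) in A_gt0 A_le1 *.
have -> : L ^+ 2 - A * ((y + 1)%:~R - c) ^+ 2 - (L ^+ 2 - A * (y%:~R - c) ^+ 2) =
    - (A * (2 * y%:~R - 2 * c + 1)) by rewrite rmorphD /=; ring.
rewrite normrN normrM gtr0_norm //.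
have yK' : `|y%:~R| <= K%:R :> R by rewrite -intr_norm -abszE -pmulrn ler_nat.
apply: (@le_trans _ _ `|2 * y%:~R - 2 * c + 1|); first by rewrite ler_piMl.
apply: le_trans (ler_normD _ _) _; rewrite normr1 lerD2r.
apply: le_trans (ler_normB _ _) _.
by rewrite !normrM !normr_nat; lra.
Qed.

(** [2 * even y - 1 + e] is the nonnegative quantity of [beatty_even_shift] up to a difference
    [g (y + h) - g y], whose weighted sum is small by [zrange_shift]. *)
Lemma even_average (K : nat) (e b : R) (h o : int) : -2 < lambda < 2 ->
  0 <= e <= 1 -> lambda * h%:~R = 2 * o%:~R + 1 + e ->
  (forall y, (absz y <= K)%N -> `|row_weight (y + 1) - row_weight y| <= b) ->
  - (`|h|%:~R * (2 * L ^+ 2 + K.*2.+1%:R * b)) <=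
  \sum_(y <- zrange K) row_weight y * (2 * even y - 1 + e).
Proof.
move=> lambda_itv e_itv eh lip.
pose g y := even y - w y.
have g_le1 y : `|g y| <= 1.
  have := beatty_frac_itv lambda eta y; rewrite /g /beatty_even ler_norml.
  by case: odd => /=; lra.
have tauM y : 0 <= row_weight y <= L ^+ 2.
  by rewrite row_weight_ge0 row_weight_le.
have shift := zrange_shift h tauM lip g_le1.
have -> : \sum_(y <- zrange K) row_weight y * (2 * even y - 1 + e) =
  \sum_(y <- zrange K) row_weight y *
    (even y + even (y + h) - 1 + e + w y - w (y + h))
  - \sum_(y <- zrange K) row_weight y * (g (y + h) - g y).
  by rewrite -sumrB; apply: eq_bigr => y _; rewrite /g; ring.
have pos : 0 <= \sum_(y <- zrange K) row_weight y *
    (even y + even (y + h) - 1 + e + w y - w (y + h)).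
  apply: sumr_ge0 => y _; apply: mulr_ge0; first exact: row_weight_ge0.
  exact: beatty_even_shift eh.
by move: shift; rewrite ler_norml => /andP[_]; lra.
Qed.

(** The choice of [d] bounds its term by [L ^ 3 / 64]; all others are [O(L ^ 2)] and fit into
    another [L ^ 3 / 64]. Here [N] stands for the number of rows, [b] for a Lipschitz bound on
    [row_weight] and [H] for the size of the shift. *)
Lemma surplus_arith (C N b H d : R) : 1 <= C -> 8 <= L ->
  0 <= N <= 5 * C * L -> 0 <= b <= 6 * C * L -> 0 <= H -> 0 <= d ->
  d * (5 * C) = 64^-1 -> 64 * (16 * H * C ^+ 2 + 20 * C) <= L ->
  N + H * (2 * L ^+ 2 + N * b) / 2 + d * (N * L ^+ 2) + N * (2 * L + 1)
    <= L ^+ 3 / 32.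
Proof.
move=> C_ge1 L_ge8 /andP[N_ge0 N_le] /andP[b_ge0 b_le] H_ge0 d_ge0 dC L_ge.
have L2_ge0 := sqr_ge0 L.
have C2_ge1 : 1 <= C ^+ 2 by rewrite -[1](expr1n _ 2) ler_sqr ?nnegrE; lra.
have Nb : N * b <= 30 * (C ^+ 2 * L ^+ 2).
  have -> : 30 * (C ^+ 2 * L ^+ 2) = (5 * C * L) * (6 * C * L) by ring.
  exact: ler_pM.
have t1 : H * (2 * L ^+ 2 + N * b) <= H * (32 * C ^+ 2 * L ^+ 2).
  apply: ler_wpM2l => //.
  by have := ler_wpM2r L2_ge0 C2_ge1; lra.
have t2 : d * (N * L ^+ 2) <= L ^+ 3 / 64.
  have -> : L ^+ 3 / 64 = d * (5 * C * L * L ^+ 2).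
    by rewrite -[64^-1]dC; ring.
  by rewrite ler_wpM2l // ler_wpM2r.
have t3 : N * (2 * L + 2) <= 20 * C * L ^+ 2.
  have -> : 20 * C * L ^+ 2 = (5 * C * L) * (4 * L) by ring.
  by apply: ler_pM => //; lra.
have t4 : (16 * H * C ^+ 2 + 20 * C) * L ^+ 2 <= L ^+ 3 / 64.
  have -> : L ^+ 3 / 64 = L / 64 * L ^+ 2 by ring.
  by rewrite ler_wpM2r //; lra.
by lra.
Qed.

Lemma surplus (K : nat) (C d e : R) (h o : int) : -2 < lambda < 2 ->
  (2 + lambda) * c = kappa - eta ->
  0 <= e <= 1 -> lambda * h%:~R = 2 * o%:~R + 1 + e ->
  (forall y, `|kappa - w y| <= (1 - e) / 2 + d) ->
  1 <= C -> 0 <= d -> d * (5 * C) = 64^-1 ->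
  8 <= L -> 8 * `|c| <= L ->
  64 * (16 * `|h|%:~R * C ^+ 2 + 20 * C) <= L ->
  C * L <= K%:R <= C * L + 1 ->
  \sum_(p <- [seq (x, y) | x <- zrange K, y <- zrange K])
    Num.max 0 (weight p - weight (F p)) + L ^+ 3 / 32 <=
  \sum_(x <- zrange K) weight (x, x) +
  \sum_(y <- zrange K | ~~ odd (absz (m y))) weight (y, - (m y %/ 2)%Z).
Proof.
move=> lambda_itv c_def e_itv eh kappa_le C_ge1 d_ge0 dC L_ge8 c_le L_ge /andP[K_ge K_le].
have kappa_le1 y : `|kappa - w y| <= 1.
  apply: le_trans (kappa_le y) _.
  have : d * 1 <= d * (5 * C) by rewrite ler_wpM2l //; lra.
  by lra.
have L_ge0 : 0 <= L by lra.
have CL : L <= C * L by rewrite ler_peMl.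
have N_def : K.*2.+1%:R = 2 * K%:R + 1 :> R by rewrite -[LHS]natr1 -muln2 natrM mulrC.
have lip y := @row_weight_lipschitz K y lambda_itv.
have N_itv : 0 <= (K.*2.+1%:R : R) <= 5 * C * L by have := ler0n R K; rewrite N_def; lra.
have b_itv : 0 <= 2 * K%:R + 2 * `|c| + 1 <= 6 * C * L.
  by have := normr_ge0 c; have := ler0n R K; lra.
have h_ge0 : 0 <= `|h|%:~R :> R by rewrite ler0z.
have arith := surplus_arith C_ge1 L_ge8 N_itv b_itv h_ge0 d_ge0 dC L_ge.
have diag := diagonal_sum lambda_itv L_ge8 c_le (le_trans CL K_ge).
have ev := even_sum L K c_def kappa_le1.
have var := variation_bound lambda_itv K c_def kappa_le1 L_ge0.
have avg := even_average lambda_itv e_itv eh lip.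
have rows : \sum_(y <- zrange K) row_weight y <= K.*2.+1%:R * L ^+ 2.
  by apply: zrange_le_cst => y _; exact: row_weight_le.
(* Here [(1 - e) / 2] is written as [even y - (2 * even y - 1 + e) / 2], whose last term is
   controlled by [even_average]. *)
have drift : \sum_(y <- zrange K) `|kappa - w y| * row_weight y <=
    \sum_(y <- zrange K) even y * row_weight y
    - (\sum_(y <- zrange K) row_weight y * (2 * even y - 1 + e)) / 2
    + d * \sum_(y <- zrange K) row_weight y.
  rewrite mulr_suml mulr_sumr -sumrB -big_split; apply: ler_sum => y _ /=.
  have := ler_wpM2r (row_weight_ge0 lambda c L y) (kappa_le y); lra.
have drows := ler_wpM2l d_ge0 rows.
by move: arith diag ev var avg drift drows; clear; lra.
Qed.

End Surplus.

(** * From surplus weight to periodic orbits *)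

Section Counting.
Variables (R : realType) (lambda eta : R).
Local Notation F := (drot lambda eta).
Local Notation m := (beatty lambda eta).

Definition box (K : nat) : seq (int * int) :=
  [seq (x, y) | x <- zrange K, y <- zrange K].

Lemma box_uniq K : uniq (box K).
Proof. by apply: allpairs_uniq; rewrite ?zrange_uniq // => -[a b] [a' b']. Qed.

Lemma mem_box K p : (p \in box K) = (absz p.1 <= K)%N && (absz p.2 <= K)%N.
Proof.
case: p => x y; rewrite -!mem_zrange /=; apply/allpairsP/idP.
  by case=> -[a b] /= [aK bK [-> ->]]; rewrite aK.
by case/andP=> xK yK; exists (x, y).
Qed.

Lemma symmetric_sum_le (K : nat) (V : int * int -> R) :
  (forall p, 0 <= V p) -> (forall p, 0 < V p -> p \in box K) ->
  \sum_(x <- zrange K) V (x, x) +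
  \sum_(y <- zrange K | ~~ odd (absz (m y))) V (y, - (m y %/ 2)%Z) <=
  \sum_(p <- box K | `[< symmetric lambda eta false p >]) V p +
  \sum_(p <- box K | `[< symmetric lambda eta true p >]) V p.
Proof.
move=> V_ge0 V_supp; rewrite -[X in _ <= X + _]big_filter -[X in _ <= _ + X]big_filter.
apply: lerD.
  rewrite -(big_map (fun x => (x, x)) xpredT V); apply: ler_sum_uniq_sub => //.
  - by rewrite map_inj_uniq ?zrange_uniq // => x y [].
  - by rewrite filter_uniq ?box_uniq.
  move=> _ /mapP[x _ ->] Vx; rewrite mem_filter V_supp // andbT.
  exact/asboolP/symmetric_diagonal.
rewrite -[leLHS]big_filter -(big_map (fun y => (y, - (m y %/ 2)%Z)) xpredT V).
apply: ler_sum_uniq_sub => //.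
- by rewrite map_inj_uniq ?filter_uniq ?zrange_uniq // => x y [].
- by rewrite filter_uniq ?box_uniq.
move=> _ /mapP[y + ->] Vy; rewrite !mem_filter V_supp // andbT => /andP[m_even _].
exact/asboolP/symmetric_even.
Qed.

Definition staying (K : nat) (V : int * int -> R) (t : bool) :=
  [seq p <- box K | `[< symmetric lambda eta t p /\ stays F V p >]].

Lemma staying_count (K : nat) (V : int * int -> R) (M : R) :
  (forall p, 0 <= V p <= M) -> (forall p, V (swap p) = V p) ->
  (forall p, 0 < V p -> p \in box K) ->
  \sum_(x <- zrange K) V (x, x) +
  \sum_(y <- zrange K | ~~ odd (absz (m y))) V (y, - (m y %/ 2)%Z) <=
  \sum_(p <- box K) Num.max 0 (V p - V (F p))
    + M * ((size (staying K V false))%:R + (size (staying K V true))%:R).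
Proof.
move=> V_itv V_swap V_supp.
have V_ge0 p : 0 <= V p by case/andP: (V_itv p).
apply: le_trans (symmetric_sum_le V_ge0 V_supp) _.
pose sym t p := `[< symmetric lambda eta t p >].
pose st p := `[< stays F V p >].
have symst t p : `[< symmetric lambda eta t p /\ stays F V p >] = sym t p && st p.
  by rewrite asbool_and.
have good t : \sum_(p <- box K | sym t p && st p) V p <= M * (size (staying K V t))%:R.
  rewrite (eq_bigl (fun p => `[< symmetric lambda eta t p /\ stays F V p >])) //.
  rewrite -big_filter -/(staying K V t) mulr_natr.
  have -> : M *+ size (staying K V t) = \sum_(p <- staying K V t) M.
    by rewrite big_const_seq count_predT iter_addr_0.
  by apply: ler_sum => p _; case/andP: (V_itv p).
have bad : \sum_(p <- box K | sym false p && ~~ st p) V p +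
    \sum_(p <- box K | sym true p && ~~ st p) V p <=
    \sum_(p <- box K) Num.max 0 (V p - V (F p)).
  pose B p := symmetric lambda eta false p \/ symmetric lambda eta true p.
  have ret p k : B p -> B (iter k.+1 F p) ->
      (forall j, (j <= k.+1)%N -> 0 < V (iter j F p)) -> stays F V p.
    have Psw q : 0 < V q -> 0 < V (swap q) by rewrite V_swap.
    by move=> [] sp [] sq pos; exact: (symmetric_return_stay Psw sp sq pos).
  apply: le_trans (escaping_bound (@drot_inj _ lambda eta) (box_uniq K) V_ge0 V_supp ret).
  rewrite big_mkcond [X in _ + X]big_mkcond [leRHS]big_mkcond -big_split.
  apply: ler_sum => p _ /=.
  rewrite asbool_and asbool_neg -/(st p) asbool_or -/(sym false p) -/(sym true p).
  have [stp|nst] := boolP (st p); first by rewrite !andbF addr0.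
  rewrite !andbT; case: (boolP (sym false p)) => [/asboolP sf|] /=; last by rewrite add0r.
  case: (boolP (sym true p)) => [/asboolP s1|] /=; last by rewrite addr0.
  (* A point symmetric in both ways is fixed by [F]; if it does not stay, its weight is 0 and
     counting it twice is harmless. *)
  have [Vp|V_le0] := ltrP 0 (V p).
    have fixp : F p = p := symmetric_both sf s1.
    by case/negP: nst; apply/asboolP => i; rewrite iter_fix.
  have -> : V p = 0 by apply/le_anti; rewrite V_le0 V_ge0.
  by rewrite addr0.
have split t : \sum_(p <- box K | sym t p) V p =
    \sum_(p <- box K | sym t p && st p) V p +
    \sum_(p <- box K | sym t p && ~~ st p) V p by rewrite (bigID st).
have := good false; have := good true; rewrite !split; lra.
Qed.

(** The 4 accounts for the two types of symmetry and for up to two symmetric points of one type on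
    an orbit. Staying orbits remain in a finite box, hence are periodic. *)
Lemma many_orbits (K : nat) (V : int * int -> R) (M r a : R) :
  (forall p, 0 <= V p <= M) -> (forall p, V (swap p) = V p) ->
  (forall p, 0 < V p -> p \in box K /\ lattice_ball r p) -> 0 < M ->
  \sum_(p <- box K) Num.max 0 (V p - V (F p)) + M * (4 * a) <=
  \sum_(x <- zrange K) V (x, x) +
  \sum_(y <- zrange K | ~~ odd (absz (m y))) V (y, - (m y %/ 2)%Z) ->
  exists n : nat, a <= n%:R /\ `I_n #<= periodic_orbits_within lambda eta r.
Proof.
move=> V_itv V_swap V_supp M_gt0 surplus.
have V_box p : 0 < V p -> p \in box K by case/V_supp.
have count := staying_count V_itv V_swap V_box.
have [t a_le] : exists t, 2 * a <= (size (staying K V t))%:R.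
  have : M * (4 * a) <= M * ((size (staying K V false))%:R + (size (staying K V true))%:R).
    by lra.
  rewrite ler_pM2l // => le4.
  have [le2|gt2] := lerP (2 * a) (size (staying K V false))%:R; first by exists false.
  by exists true; lra.
have [||n [n_ge n_card]] := @orbits_of_symmetric_points _ lambda eta r t (staying K V t).
- by rewrite filter_uniq ?box_uniq.
- move=> p; rewrite mem_filter => /andP[/asboolP[sp st] _].
  have perp : drot_periodic lambda eta p.
    by apply: (@bounded_periodic _ _ _ (box K)) => i; apply: V_box.
  split=> // q /(drot_orbit_iter perp)[i ->].
  by case: (V_supp _ (st i)).
exists n; split=> //.
by move: n_ge; rewrite -(ler_nat R) -muln2 natrM; lra.
Qed.

End Counting.

(** * The linear bound and the choice of constants *)

Theorem corollary3 (R : realType) (lambda eta : R)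
    (hlambda : -2 < lambda < 2) :
  exists C r0 : R,
    [/\ 0 < C, 0 < r0 &
      forall r : R, r0 <= r ->
        exists n : nat,
          C * r <= n%:R /\ `I_n #<= periodic_orbits_within lambda eta r].
Proof.
have /andP[A_gt0 A_le1] := ellipticity_itv hlambda.
set A := (1 - lambda ^+ 2 / 4) in A_gt0 A_le1.
have [lo hi] := andP hlambda.
(* [C * L] will bound both coordinates on the support of the weight, once [|c| <= L]. *)
pose C : R := A^-1 + 1.
have C_ge1 : 1 <= C by rewrite lerDr invr_ge0 ltW.
have C_gt0 : 0 < C by lra.
pose d : R := (64 * (5 * C))^-1.
have d_gt0 : 0 < d by rewrite invr_gt0; lra.
have dC : d * (5 * C) = 64^-1 by rewrite /d; field; lra.
have [kappa [e [h [o [e_itv eh kappa_le]]]]] := approximation lambda eta d_gt0.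
pose c := (kappa - eta) / (2 + lambda).
have c_def : (2 + lambda) * c = kappa - eta by rewrite /c; field; lra.
pose L0 := 8 + 8 * `|c| + 64 * (16 * `|h|%:~R * C ^+ 2 + 20 * C).
have h_ge0 : 0 <= `|h|%:~R :> R by rewrite ler0z.
have c_ge0 := normr_ge0 c.
have hC_ge0 : 0 <= 16 * `|h|%:~R * C ^+ 2 by rewrite mulr_ge0 ?sqr_ge0 // mulr_ge0.
have L0_gt0 : 0 < L0 by rewrite /L0; lra.
(* With [r = 2 * C * L] the count is [L / 128], and [L ^ 2 * (4 * (L / 128))] is the surplus
   [L ^ 3 / 32]. *)
exists (256 * C)^-1, (2 * C * L0); split.
- by rewrite invr_gt0; lra.
- by rewrite !mulr_gt0.
move=> r r_ge; pose L := r / (2 * C).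
have er : r = 2 * C * L by rewrite /L; field; lra.
have L_ge : L0 <= L by rewrite /L ler_pdivlMr ?mulr_gt0 // mulrC.
have L_ge8 : 8 <= L by move: L_ge; rewrite /L0; lra.
have L_gec : 8 * `|c| <= L by move: L_ge; rewrite /L0; lra.
have L_ge' : 64 * (16 * `|h|%:~R * C ^+ 2 + 20 * C) <= L by move: L_ge; rewrite /L0; lra.
have L_ge0 : 0 <= L by lra.
pose K := (Num.truncn (C * L)).+1.
have CL_ge0 : 0 <= C * L by rewrite mulr_ge0 // ltW.
have K_itv : C * L <= K%:R <= C * L + 1.
  have /andP[lek ltk] := truncn_itv CL_ge0.
  by rewrite /K (ltW ltk) /= -natr1 lerD2r.
have sur := surplus hlambda c_def e_itv eh kappa_le C_ge1 (ltW d_gt0) dC L_ge8 L_gec L_ge' K_itv.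
have -> : (256 * C)^-1 * r = L / 128 by rewrite er; field; lra.
apply: (@many_orbits _ lambda eta K (weight lambda c L) (L ^+ 2)).
- by move=> p; rewrite weight_ge0 weight_le.
- exact: weight_swap.
- move=> p /(weight_supp hlambda L_ge0); rewrite -/A.
  have bound (z : int) : `|z%:~R| <= L / A + `|c| -> `|z%:~R| <= C * L.
    by move=> z_le; rewrite /C; lra.
  case=> /bound p1 /bound p2.
  have inK (z : int) : `|z%:~R| <= C * L -> (absz z <= K)%N.
    have [K_ge _] := andP K_itv.
    move=> z_le; rewrite -(ler_nat R) pmulrn abszE intr_norm.
    exact: le_trans K_ge.
  split; first by rewrite mem_box !inK.
  (* The square of half-side [C * L] lies in the disc of radius [2 * C * L], as [sqrt 2 < 2]. *)
  rewrite /lattice_ball /= er.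
  have sq (x : R) : `|x| <= C * L -> x ^+ 2 <= (C * L) ^+ 2.
    by move=> x_le; rewrite -real_normK ?num_real // ler_sqr ?nnegrE.
  have CL_gt0 : 0 < C * L by rewrite mulr_gt0 //; lra.
  have CL2_gt0 : 0 < (C * L) ^+ 2 by rewrite exprn_gt0.
  rewrite -[ltRHS]ger0_norm -?sqrtr_sqr; last by lra.
  rewrite ltr_sqrt; last by rewrite exprn_gt0 //; lra.
  have -> : 2 * C * L = 2 * (C * L) by ring.
  by rewrite exprMn; have := sq _ p1; have := sq _ p2; lra.
- by rewrite exprn_gt0 //; lra.
have -> : L ^+ 2 * (4 * (L / 128)) = L ^+ 3 / 32 by field.
exact: sur.
Qed.
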